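(* Let $\mathcal H$ be an infinite dimensional separable complex Hilbert space and let $\mathrm U(\mathcal H)$ be the group of all unitary operators $\mathcal H\to\mathcal H$. Then $\mathrm U(\mathcal H)$, equipped with the strong topology, is a contractible topological space.
   Context: The strong topology on $\mathrm U(\mathcal H)$ is the strong operator topology, i.e. the topology of pointwise convergence on $\mathcal H$ in norm, induced by the seminorms $T\mapsto\|Tf\|$, $f\in\mathcal H$. *)

(* Defs.v *)
From HB Require Import structures.
From mathcomp Require Import all_boot all_order all_algebra sesquilinear.
From mathcomp Require Import complex.
From mathcomp Require Import all_classical all_reals.
From mathcomp Require Import topology normedtype.

Set Implicit Arguments.
Unset Strict Implicit.
Unset Printing Implicit Defensive.

Import Order.TTheory GRing.Theory Num.Theory Num.Def.
Import numFieldNormedType.Exports.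

Local Open Scope classical_set_scope.
Local Open Scope ring_scope.
Local Open Scope complex_scope.

Definition homotopic (R : realType) (X Y : topologicalType) (f g : X -> Y) :=
  exists F : R * X -> Y,
    [/\ {within `[0, 1] `*` [set: X], continuous F},
        forall x, F (0, x) = f x
      & forall x, F (1, x) = g x].

Definition contractible (R : realType) (X : topologicalType) :=
  exists x0 : X, homotopic R (@idfun X) (cst x0).

Definition separable_space (X : topologicalType) :=
  exists2 D : set X, countable D & dense D.

Definition finite_dimensional (K : fieldType) (V : lmodType K) :=
  exists s : seq V, forall v : V,
    exists c : 'I_(size s) -> K, v = \sum_i c i *: s`_i.

Definition infinite_dimensional (K : fieldType) (V : lmodType K) :=
  ~ finite_dimensional V.

(* A complex Hilbert space is given by a complete normed space H over R[i]
   together with a scalar product (linear in its first argument) that induces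
   the norm of H. *)
Definition induces_norm (R : realType) (H : normedModType R[i])
    (dot : {dot H for conjC}) :=
  forall x : H, `|x| ^+ 2 = dot x x.

Definition unitary (R : realType) (H : normedModType R[i])
    (dot : {dot H for conjC}) (T : H -> H) :=
  [/\ linear T, bijective T & isometry dot dot T].

(* As a subtype of {ptws H -> H}, U(H) inherits the topology of pointwise
   convergence in norm, i.e., the strong operator topology. *)
Definition unitary_group (R : realType) (H : normedModType R[i])
    (dot : {dot H for conjC}) : Type :=
  set_type [set T : {ptws H -> H} | unitary dot T].

HB.instance Definition _ (R : realType) (H : normedModType R[i])
    (dot : {dot H for conjC}) :=
  Topological.copy (unitary_group dot)
    (set_type [set T : {ptws H -> H} | unitary dot T]).

Section unitary_group_group.
Context (R : realType) (H : normedModType R[i]) (dot : {dot H for conjC}).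
Implicit Types T U : unitary_group dot.

Lemma unitary_id : unitary dot idfun.
Proof. by split=> //; exists idfun. Qed.

Lemma unitary_comp (f g : H -> H) :
  unitary dot f -> unitary dot g -> unitary dot (f \o g).
Proof.
move=> [lf bf df] [lg bg dg]; split.
- by move=> a x y /=; rewrite lg lf.
- exact: bij_comp.
- by move=> x y /=; rewrite df dg.
Qed.

Lemma unitary_inv (f g : H -> H) :
  cancel f g -> cancel g f -> unitary dot f -> unitary dot g.
Proof.
move=> fg gf [lf bf df]; split.
- by move=> a x y; apply: (can_inj fg); rewrite lf !gf.
- by exists f.
- by move=> x y; rewrite -df !gf.
Qed.

Lemma unitary_groupP T : unitary dot (set_val T).
Proof. exact: set_valP T. Qed.

Definition to_unitary (f : H -> H) (uf : unitary dot f) : unitary_group dot :=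
  exist _ (f : {ptws H -> H}) (mem_set uf).

Lemma unitary_group_inj T U : set_val T =1 set_val U -> T = U.
Proof. by move=> /funext TU; apply: val_inj. Qed.

Lemma unitary_inverse T :
  exists U, cancel (set_val T) (set_val U) /\ cancel (set_val U) (set_val T).
Proof.
have uT := unitary_groupP T; have [_ [g fg gf] _] := uT.
by exists (to_unitary (unitary_inv fg gf uT)).
Qed.

Definition unitary_mul T U :=
  to_unitary (unitary_comp (unitary_groupP T) (unitary_groupP U)).

Definition unitary_invg T := projT1 (cid (unitary_inverse T)).

Lemma unitary_mulA : associative unitary_mul.
Proof. by move=> T U V; apply: unitary_group_inj. Qed.

Lemma unitary_mul1g : left_id (to_unitary unitary_id) unitary_mul.
Proof. by move=> T; apply: unitary_group_inj. Qed.

Lemma unitary_mulg1 : right_id (to_unitary unitary_id) unitary_mul.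
Proof. by move=> T; apply: unitary_group_inj. Qed.

Lemma unitary_mulVg :
  left_inverse (to_unitary unitary_id) unitary_invg unitary_mul.
Proof.
move=> T; apply: unitary_group_inj => x.
by rewrite /unitary_invg; case: cid => U [TU _] /=; exact: TU.
Qed.

Lemma unitary_mulgV :
  right_inverse (to_unitary unitary_id) unitary_invg unitary_mul.
Proof.
move=> T; apply: unitary_group_inj => x.
by rewrite /unitary_invg; case: cid => U [_ UT] /=; exact: UT.
Qed.

HB.instance Definition _ := isGroup.Build (unitary_group dot)
  unitary_mulA unitary_mul1g unitary_mulg1 unitary_mulVg unitary_mulgV.

End unitary_group_group.

Lemma strong_cvgP (R : realType) (H : normedModType R[i])
    (dot : {dot H for conjC}) (F : set_system (unitary_group dot))
    (T : unitary_group dot) : Filter F ->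
  F --> T <->
  forall x, (fun U : unitary_group dot => set_val U x) @ F --> set_val T x.
Proof.
move=> FF.
pose v : unitary_group dot -> {ptws H -> H} := set_val.
have -> : F --> T <-> v @ F --> v T.
  split=> [FT|FT A [_ [[B oB <-] BT] BA]].
    apply: cvg_trans (cvg_app v FT) _.
    exact: (@initial_continuous _ _ v T).
  by apply: filterS BA _; apply: FT; exact: open_nbhs_nbhs.
exact: pointwise_cvgP.
Qed.

Lemma strong_normP (R : realType) (H : normedModType R[i])
    (dot : {dot H for conjC}) (F : set_system (unitary_group dot))
    (T : unitary_group dot) : Filter F ->
  F --> T <-> forall x (e : R[i]), 0 < e ->
    \forall U \near F, `|set_val T x - set_val U x| < e.
Proof.
move=> FF; rewrite strong_cvgP.
by split=> h x; apply/cvgrPdist_lt; exact: h.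
Qed.

(* Main.v *)
(** Fix an orthonormal basis [e] and let [V t], for [0 <= t < 1], be a path of
    isometries with [V 0 = 1].  Then [V U V^* + 1 - V V^*] is unitary, and it
    contracts [U] to the identity as soon as the adjoints [V t^*] are strongly
    continuous in [t] and tend strongly to [0] as [t] tends to [1].  No
    continuity of [V t] itself is needed, because on unitary operators the weak
    and the strong topology coincide.

    Such a path is obtained by moving the basis vectors one at a time: during
    the [j]-th stage, the vector that started at [e k] is rotated from
    [e (k + j)] to [e (k + j + 1)] in the plane they span, the larger indices
    [k] moving first, so that the target is already free.  Infinitely many
    stages, each made of infinitely many rotations, fit into the interval
    [[0, 1[]; after [j] stages the isometry is the [j]-th power of the shift. *)

Require Import Defs.
From HB Require Import structures.
From mathcomp Require Import all_boot all_order all_algebra sesquilinear.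
From mathcomp Require Import complex.
From mathcomp Require Import all_classical all_reals.
From mathcomp Require Import topology normedtype sequences realfun ring zify.
Import Order.TTheory GRing.Theory Num.Theory Num.Def.
Import numFieldNormedType.Exports.
Local Open Scope classical_set_scope.
Local Open Scope ring_scope.
Local Open Scope complex_scope.

Set Implicit Arguments.
Unset Strict Implicit.
Unset Printing Implicit Defensive.

(** * Cauchy-Schwarz, continuity of the scalar product, Bessel's inequality *)

Section dot_theory.
Context (R : realType) (H : normedModType R[i]) (dot : {dot H for conjC}).
Hypothesis dot_norm : induces_norm dot.
Implicit Types x y z : H.

Lemma dotC x y : dot x y = conjC (dot y x).
Proof. by rewrite hermC expr0 mul1r. Qed.

Lemma dotZl a x y : dot (a *: x) y = a * dot x y.
Proof. by rewrite linearZl. Qed.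

Lemma dotZr a x y : dot x (a *: y) = conjC a * dot x y.
Proof. by rewrite linearZr. Qed.

(** Expands the nonnegative square of the norm of [<y,y> x - <x,y> y], which is [<y,y>] times the
    difference of the two squared sides. *)
Lemma cauchy_schwarz x y : `|dot x y| <= `|x| * `|y|.
Proof.
have [->|y0] := eqVneq y 0; first by rewrite linear0r !normr0 mulr0.
rewrite -(ler_pXn2r (n := 2)) ?nnegrE ?mulr_ge0//.
have yy_gt0 : 0 < dot y y by rewrite dnorm_gt0.
have yyC : conjC (dot y y) = dot y y by rewrite -dotC.
rewrite exprMn !dot_norm normCK -subr_ge0 -(pmulr_rge0 _ yy_gt0).
have := dnorm_ge0 dot (dot y y *: x - dot x y *: y).
rewrite dnormB !dnormZ !dotZl !dotZr !normCK yyC.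
rewrite !rmorphM /= yyC -!(dotC y x) -(dotC x y) => h.
by congr (0 <= _) : h; ring.
Qed.

Lemma dot_cvgl {T : Type} (F : set_system T) {FF : Filter F} (f : T -> H) x y :
  f @ F --> x -> (fun t => dot (f t) y : R[i]^o) @ F --> (dot x y : R[i]^o).
Proof.
move=> /cvgrPdist_lt fx; apply/cvgrPdist_lt => e e0.
(* The added 1 makes the bound a legitimate divisor even when [y] is 0. *)
have y1 : 0 < `|y| + 1 by rewrite ltr_wpDl.
near=> t; rewrite -linearBl (le_lt_trans (cauchy_schwarz _ _))//.
rewrite (@le_lt_trans _ _ (`|x - f t| * (`|y| + 1)))//.
  by rewrite ler_wpM2l// lerDl.
rewrite -ltr_pdivlMr//; near: t; apply: fx; exact: divr_gt0.
Unshelve. all: by end_near. Qed.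

Lemma dot_cvg {T : Type} (F : set_system T) {FF : Filter F} (f g : T -> H) x y :
  f @ F --> x -> g @ F --> y -> (fun t => dot (f t) (g t) : R[i]^o) @ F --> (dot x y : R[i]^o).
Proof.
move=> fx gy.
(* Expansion around the limit point: a linear term in each variable and a product of two small
   factors. *)
have -> : (fun t => dot (f t) (g t) : R[i]^o) =
    (fun t => dot (f t) y + dot (f t - x) (g t - y) + dot x (g t - y)).
  by apply/funext => t; rewrite linearBl linearBr/= [dot x (_ - _)]linearBr; ring.
rewrite -[X in _ --> X]addr0 -[X in _ --> X + _]addr0.
apply: cvgD; first apply: cvgD.
- exact: dot_cvgl.
- apply/cvgrPdist_lt => e e0; near=> t.
  rewrite sub0r normrN (le_lt_trans (cauchy_schwarz _ _))//.
  rewrite (@le_lt_trans _ _ (1 * `|g t - y|))//.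
    rewrite ler_wpM2r// ltW// distrC; near: t.
    by move/cvgrPdist_lt : fx; apply.
  by rewrite mul1r distrC; near: t; move/cvgrPdist_lt : gy; apply.
- apply/cvgrPdist_lt => e e0.
  have x1 : 0 < `|x| + 1 by rewrite ltr_wpDl.
  near=> t; rewrite sub0r normrN (le_lt_trans (cauchy_schwarz _ _))//.
  rewrite (@le_lt_trans _ _ ((`|x| + 1) * `|y - g t|))//.
    by rewrite distrC ler_wpM2r// lerDl.
  rewrite mulrC -ltr_pdivlMr//; near: t; move/cvgrPdist_lt : gy; apply.
  exact: divr_gt0.
Unshelve. all: by end_near. Qed.

Definition orthonormal_family (v : nat -> H) :=
  forall i j, dot (v i) (v j) = (i == j)%:R.

(** Orthonormality is asked on the summation range only, so that a finite list read through [nth]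
    with default 0 qualifies. *)
Lemma dot_sum_delta v (a : nat -> R[i]) m n j :
  (forall i, (m <= i < n)%N -> dot (v i) (v j) = (i == j)%:R) ->
  dot (\sum_(m <= k < n) a k *: v k) (v j) = if (m <= j < n)%N then a j else 0.
Proof.
move=> vj; rewrite linear_sumlz /=.
under eq_big_nat => i imn do rewrite dotZl vj// mulr_natr mulrb.
by rewrite -big_mkcond/= big_nat1_eq.
Qed.

Lemma dot_sum_orthonormal v (a : nat -> R[i]) m n j : orthonormal_family v ->
  dot (\sum_(m <= k < n) a k *: v k) (v j) = if (m <= j < n)%N then a j else 0.
Proof. by move=> von; apply: dot_sum_delta => i _; exact: von. Qed.

Lemma norm_sum_orthonormal v (a : nat -> R[i]) m n : orthonormal_family v ->
  `|\sum_(m <= k < n) a k *: v k| ^+ 2 = \sum_(m <= k < n) `|a k| ^+ 2.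
Proof.
move=> von; rewrite dot_norm [LHS]linear_sumr /=.
rewrite big_nat_cond [RHS]big_nat_cond; apply: eq_bigr => k /andP[kmn _].
by rewrite dotZr dot_sum_orthonormal// kmn mulrC normCK.
Qed.

Lemma pythagoras v x n : orthonormal_family v ->
  `|x - \sum_(0 <= k < n) dot x (v k) *: v k| ^+ 2 =
  `|x| ^+ 2 - \sum_(0 <= k < n) `|dot x (v k)| ^+ 2.
Proof.
move=> von; set y := \sum_(0 <= k < n) dot x (v k) *: v k.
have xy : dot x y = \sum_(0 <= k < n) `|dot x (v k)| ^+ 2.
  by rewrite linear_sumr/=; apply: eq_bigr => k _; rewrite dotZr mulrC normCK.
have yx : dot y x = \sum_(0 <= k < n) `|dot x (v k)| ^+ 2.
  rewrite linear_sumlz/=; apply: eq_bigr => k _.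
  by rewrite dotZl [dot (v k) x]dotC normCK.
rewrite [LHS]dot_norm dnormB -dotC -!dot_norm xy yx norm_sum_orthonormal//.
by rewrite opprD addrA addrK.
Qed.

Lemma bessel v x n : orthonormal_family v ->
  \sum_(0 <= k < n) `|dot x (v k)| ^+ 2 <= `|x| ^+ 2.
Proof. by move=> von; rewrite -subr_ge0 -pythagoras// exprn_ge0. Qed.

Lemma norm_residue v x n : orthonormal_family v ->
  `|x - \sum_(0 <= k < n) dot x (v k) *: v k| <= `|x|.
Proof.
move=> von; rewrite -(ler_pXn2r (n := 2)) ?nnegrE// pythagoras//.
by rewrite gerBl sumr_ge0// => k _; rewrite exprn_ge0.
Qed.

End dot_theory.

(** * Partial isometries between orthonormal families *)

Section orthonormal_maps.
Context (R : realType) (H : completeNormedModType R[i]) (dot : {dot H for conjC}).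
Hypothesis dot_norm : induces_norm dot.
Implicit Types (x y : H) (u v w : nat -> H).

(** By Bessel the squared coefficients are summable, and their blocks are the squared norms of the
    blocks of this series; completeness of [H] concludes. *)
Lemma cvg_orthonormal v w x :
  orthonormal_family dot v -> orthonormal_family dot w ->
  cvgn (series (fun k => dot x (v k) *: w k)).
Proof.
move=> von won; apply/cauchy_cvgP/cauchy_seriesP => e e0.
(* Norms live in [R[i]]; real parts bring the series into [R], where bounded monotone sequences
   converge. *)
pose s k : R := complex.Re (`|dot x (v k)| ^+ 2).
have sC k : (s k)%:C = `|dot x (v k)| ^+ 2.
  by rewrite RRe_real// realE exprn_ge0.
have s_ge0 k : 0 <= s k by rewrite -lecR sC exprn_ge0.
have e2 : 0 < complex.Re (e ^+ 2).
  by rewrite -ltcR RRe_real ?exprn_gt0// realE exprn_ge0// ltW.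
have : cvgn (series s).
  apply: nondecreasing_is_cvgn.
    by apply: nondecreasing_series => k _ _; exact: s_ge0.
  exists (complex.Re (`|x| ^+ 2)) => _ [n _ <-].
  rewrite -lecR RRe_real ?realE ?exprn_ge0// /series /= rmorph_sum /=.
  by under eq_bigr do rewrite sC; exact: bessel.
move=> /cauchy_cvgP/cauchy_seriesP/(_ _ e2); apply: filterS => -[m n] /=.
rewrite ger0_norm ?sumr_ge0// -ltcR RRe_real; last first.
  by rewrite realE exprn_ge0// ltW.
rewrite rmorph_sum/=; under eq_bigr do rewrite sC.
rewrite -(norm_sum_orthonormal dot_norm _ _ _ won) ltr_pXn2r ?nnegrE//.
exact: ltW.
Qed.

(* The partial isometry sending each [v k] to [w k] and vanishing on the
   orthogonal complement of the [v k]. *)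
Definition pisom v w x : H := limn (series (fun k => dot x (v k) *: w k)).

Lemma cvg_pisom v w x :
  orthonormal_family dot v -> orthonormal_family dot w ->
  series (fun k => dot x (v k) *: w k) @ \oo --> pisom v w x.
Proof. by move=> von won; exact: cvg_orthonormal. Qed.

Lemma pisom_linear v w :
  orthonormal_family dot v -> orthonormal_family dot w -> linear (pisom v w).
Proof.
move=> von won a x y; apply: cvg_lim => //.
have -> : series (fun k => dot (a *: x + y) (v k) *: w k) =
    (fun n => a *: series (fun k => dot x (v k) *: w k) n +
              series (fun k => dot y (v k) *: w k) n).
  apply/funext => n; rewrite /series /= scaler_sumr -big_split/=.
  by apply: eq_bigr => k _; rewrite linearPl scalerDl scalerA.
by apply: cvgD; [apply: cvgZl_tmp|]; exact: cvg_pisom.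
Qed.

(** Holds for partial sums, then in the limit by continuity of [dot]; it makes [pisom w v] the
    adjoint of [pisom v w]. *)
Lemma dot_pisoml v w x y :
  orthonormal_family dot v -> orthonormal_family dot w ->
  dot (pisom v w x) y = dot x (pisom w v y).
Proof.
move=> von won.
apply: (@cvg_unique R[i]^o _
    (dot (series (fun k => dot x (v k) *: w k) n) y @[n --> \oo])) => //.
  by apply: dot_cvgl => //; exact: cvg_pisom.
rewrite (_ : (fun n => dot _ y) =
    (fun n => dot x (series (fun k => dot y (w k) *: v k) n))); last first.
  apply/funext => n; rewrite /series/= linear_sumlz linear_sumr/=.
  by apply: eq_bigr => k _; rewrite dotZl dotZr -dotC mulrC.
by apply: dot_cvg => //; [exact: cvg_cst|exact: cvg_pisom].
Qed.

Lemma pisom_coef v w x k :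
  orthonormal_family dot v -> orthonormal_family dot w ->
  dot (pisom v w x) (w k) = dot x (v k).
Proof.
move=> von won.
apply: (@cvg_unique R[i]^o _
    (dot (series (fun k => dot x (v k) *: w k) n) (w k) @[n --> \oo])) => //.
  by apply: dot_cvgl => //; exact: cvg_pisom.
apply: cvg_near_cst; exists k.+1 => // n /= kn.
by rewrite /series/= (dot_sum_orthonormal (fun k => dot x (v k))) // kn.
Qed.

(** Both series have the same terms, since the inner image has along [v] the coefficients of [x]
    along [u]. *)
Lemma pisom_comp u v w x :
  orthonormal_family dot u -> orthonormal_family dot v ->
  orthonormal_family dot w -> pisom v w (pisom u v x) = pisom u w x.
Proof.
move=> uon von won; rewrite /pisom; congr (limn (series _)).
by apply/funext => k; rewrite -/(pisom u v x) pisom_coef.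
Qed.

(** With the projection [P = pisom v v], the left side squared is [<x, P x>], and [|x|^2 - <x, P x>]
    is the square [|x - P x|^2]. *)
Lemma norm_pisom v w x :
  orthonormal_family dot v -> orthonormal_family dot w ->
  `|pisom v w x| <= `|x|.
Proof.
move=> von won; rewrite -(ler_pXn2r (n := 2)) ?nnegrE//.
have px : dot (pisom v v x) (pisom v v x) = dot x (pisom v v x).
  by rewrite dot_pisoml// pisom_comp.
rewrite !dot_norm dot_pisoml// pisom_comp//.
have := dnorm_ge0 dot (x - pisom v v x).
by rewrite dnormB -dotC px dot_pisoml// opprD addrA addrK subr_ge0.
Qed.

End orthonormal_maps.

(** * Gram-Schmidt and the existence of an orthonormal basis *)

Section orthonormal_basis.
Context (R : realType) (H : normedModType R[i]) (dot : {dot H for conjC}).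
Hypothesis dot_norm : induces_norm dot.
Implicit Types (x y : H) (s : seq H) (e : nat -> H).

Definition orthonormal_basis e := orthonormal_family dot e /\
  forall x, series (fun k => dot x (e k) *: e k) @ \oo --> x.

Let orthonormal_seq s := forall i j, (i < size s)%N -> (j < size s)%N ->
  dot s`_i s`_j = (i == j)%:R.

Let residue s x := x - \sum_(0 <= k < size s) dot x s`_k *: s`_k.

Let residue_orth s x j : orthonormal_seq s -> (j < size s)%N ->
  dot (residue s x) s`_j = 0.
Proof.
move=> son js; rewrite linearBl/=.
rewrite (dot_sum_delta (v := nth 0 s) (fun k => dot x s`_k)) ?js ?subrr//.
by move=> i /= /son; apply.
Qed.

Let dot_residue s x z : orthonormal_seq s ->
  dot x (residue s z) = dot (residue s x) (residue s z).
Proof.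
move=> son; rewrite [RHS]linearBl/= linear_sumlz/= big_nat_cond big1 ?subr0//.
move=> k /andP[ks _]; by rewrite dotZl [dot s`_k _]dotC residue_orth// rmorph0 mulr0.
Qed.

(** Infinite dimension supplies a new vector even when [x] already lies in the span of [s], so the
    process never stops and redundant inputs are harmless. *)
Lemma gram_schmidt_step s x : infinite_dimensional H -> orthonormal_seq s ->
  exists y, orthonormal_seq (rcons s y) /\ residue (rcons s y) x = 0.
Proof.
move=> dimH son.
(* Take [z = x] if its residue is nonzero, any vector outside the span otherwise; the scalar 1 or 0
   lets one computation serve both cases. *)
have [z z0 zx] : exists2 z, residue s z != 0 &
    residue s x = (if residue s x == 0 then 0 else 1) *: residue s z.
  have [rx0|rx] := eqVneq (residue s x) 0; last by exists x; rewrite // scale1r.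
  have [z /eqP rz] : exists z, residue s z <> 0.
    apply: contra_notP dimH => h; exists s => v.
    exists (fun i => dot v s`_i); apply: subr0_eq.
    rewrite -(big_mkord xpredT (fun k => dot v s`_k *: s`_k)).
    by apply: contrapT => vs; apply: h; exists v.
  by exists z; rewrite // scale0r.
set r := residue s z in z0 zx *.
have r0 : `|r| != 0 by rewrite normr_eq0.
have rr : dot r r = `|r| ^+ 2 by rewrite dot_norm.
have nC : conjC `|r|^-1 = `|r|^-1 by rewrite geC0_conj ?invr_ge0.
pose y := `|r|^-1 *: r.
have yy : dot y y = 1.
  by rewrite /y dotZl dotZr nC rr expr2 mulKf ?mulVf.
have ys j : (j < size s)%N -> dot y s`_j = 0.
  by move=> js; rewrite dotZl residue_orth ?mulr0.
exists y; split.
  move=> i j; rewrite size_rcons !ltnS !nth_rcons.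
  rewrite leq_eqVlt => /predU1P[->|iS]; rewrite leq_eqVlt => /predU1P[->|jS].
  - by rewrite ltnn eqxx.
  - by rewrite ltnn eqxx jS ys// eq_sym ltn_eqF.
  - by rewrite ltnn eqxx iS dotC ys// rmorph0 ltn_eqF.
  - by rewrite iS jS son.
rewrite /residue size_rcons big_nat_recr//= nth_rcons ltnn eqxx.
rewrite (eq_big_nat _ _ (F2 := fun k => dot x s`_k *: s`_k)); last first.
  by move=> i /= iS; rewrite nth_rcons iS.
rewrite opprD addrA -/(residue s x).
rewrite {2}/y dotZr dot_residue// nC zx dotZl -/r rr.
rewrite /y scalerA -scalerBl.
rewrite [X in X *: _](_ : _ = 0) ?scale0r//.
by field.
Qed.

Lemma orthonormal_basis_exists :
  infinite_dimensional H -> separable_space H -> exists e, orthonormal_basis e.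
Proof.
move=> dimH [D /countable_injP[f finj] Ddense].
(* [d] enumerates [D] through the injection [f]; indices not attained on [D] give the default 0,
   which the Gram-Schmidt step tolerates. *)
pose d n := xget (0 : H) (D `&` f @^-1` [set n]).
have dD x : D x -> d (f x) = x.
  move=> Dx; rewrite /d; case: xgetP => [y _ [Dy fyx]|/(_ x)[]//].
  by apply: finj => //; exact/mem_set.
have [g gP] : exists g : seq H -> H -> H, forall s x, orthonormal_seq s ->
    orthonormal_seq (rcons s (g s x)) /\ residue (rcons s (g s x)) x = 0.
  have /choice[g gP] : forall p : seq H * H, exists y, orthonormal_seq p.1 ->
      orthonormal_seq (rcons p.1 y) /\ residue (rcons p.1 y) p.2 = 0.
    move=> [s x]; have [son|nson] := pselect (orthonormal_seq s).
      by have [y yP] := gram_schmidt_step x dimH son; exists y.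
    by exists 0.
  by exists (fun s x => g (s, x)) => s x /(gP (s, x)).
pose S := fix S n := if n is m.+1 then rcons (S m) (g (S m) (d m)) else [::].
have Son n : orthonormal_seq (S n) by elim: n => [//|n IH]; apply: (gP _ _ IH).1.
have sizeS n : size (S n) = n by elim: n => //= n IH; rewrite size_rcons IH.
pose e n := (S n.+1)`_n.
have nthS n k : (k < n)%N -> (S n)`_k = e k.
  elim: n => // n IH; rewrite ltnS leq_eqVlt => /predU1P[->//|kn].
  by rewrite /= nth_rcons sizeS kn IH.
have eon : orthonormal_family dot e.
  move=> i j; rewrite -(nthS (maxn i j).+1) ?ltnS ?leq_maxl//.
  rewrite -(nthS (maxn i j).+1 j) ?ltnS ?leq_maxr//.
  by rewrite Son// sizeS ltnS ?leq_maxl ?leq_maxr.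
have de n : d n = series (fun k => dot (d n) (e k) *: e k) n.+1.
  have := (gP _ (d n) (Son n)).2; rewrite -[rcons _ _]/(S n.+1) /residue sizeS.
  move/eqP; rewrite subr_eq0 => /eqP {1}->.
  by apply: eq_big_nat => k kn; rewrite nthS.
(* The coefficients of [d n] beyond index [n] vanish, so every later partial sum reproduces [d n]
   exactly. *)
have dem n m : (n < m)%N -> d n = series (fun k => dot (d n) (e k) *: e k) m.
  move=> nm; rewrite {1}de /series /= (big_nat_widen _ _ _ _ _ nm) big_mkcond/=.
  apply: eq_bigr => k _; rewrite {2}de /series/=.
  rewrite (dot_sum_orthonormal (fun k => dot (d n) (e k)))// leq0n/=.
  by case: ifP; rewrite ?scale0r.
exists e; split=> // x; apply/cvgrPdist_lt => r r0.
have [y [/interior_subset xy Dy]] : (ball x r)^° `&` D !=set0.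
  apply: Ddense; last exact: open_interior.
  by exists x; exact: nbhsx_ballx.
exists (f y).+1 => // m /= ym; have := dem _ _ ym; rewrite dD// => ye.
(* Taking residues kills [y] and does not increase norms, so the error at [x] is that at [x - y],
   less than [r]. *)
rewrite (_ : x - _ = (x - y) - series (fun k => dot (x - y) (e k) *: e k) m).
  apply: le_lt_trans (norm_residue dot_norm _ _ eon) _.
  by move: xy; rewrite -ball_normE.
have -> : series (fun k => dot (x - y) (e k) *: e k) m =
    series (fun k => dot x (e k) *: e k) m - y.
  rewrite [in RHS]ye /series/= -sumrB; apply: eq_bigr => k _.
  by rewrite linearBl scalerBl.
by rewrite opprB addrA subrK.
Qed.

End orthonormal_basis.

(** * Timetable of the moves and coordinates of the moving vectors *)

Section coefficients.
Context {R : realType}.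
Implicit Types (k l j m n : nat) (t : R).

(** The end of the move of vector [k] in stage [j], which begins at [stage_time k.+1 j]. Stage [j]
    fills the interval from [1 - 1/(1+j)] to [1 - 1/(2+j)], and larger [k] come earlier in it. *)
Definition stage_time k j : R := 1 - (1 + j%:R + k.+1%:R^-1)^-1.

Lemma stage_time_le k l i j : (i < j)%N || (i == j) && (l <= k)%N ->
  stage_time k i <= stage_time l j.
Proof.
move=> ij; have k0 : 0 < k.+1%:R^-1 :> R by rewrite invr_gt0.
have l0 : 0 < l.+1%:R^-1 :> R by rewrite invr_gt0.
rewrite /stage_time lerD2l lerN2 lef_pV2 ?posrE; last 2 first.
- by rewrite ltr_wpDl// addr_ge0.
- by rewrite ltr_wpDl// addr_ge0.
case/orP : ij => [ij|/andP[/eqP-> lk]].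
  rewrite -addrA -[leRHS]addrA lerD2l.
  rewrite (@le_trans _ _ (i%:R + 1))//; first by rewrite lerD2l invf_le1// ler1n.
  by rewrite natr1 (@le_trans _ _ j%:R) ?ler_nat// lerDl ltW.
by rewrite lerD2l lef_pV2 ?posrE// ler_nat ltnS.
Qed.

Lemma stage_time_ltS k j : stage_time k.+1 j < stage_time k j.
Proof.
have k0 n : 0 < n.+1%:R^-1 :> R by rewrite invr_gt0.
rewrite /stage_time ltrD2l ltrN2 ltf_pV2 ?posrE; last 2 first.
- by rewrite ltr_wpDl// addr_ge0.
- by rewrite ltr_wpDl// addr_ge0.
by rewrite ltrD2l ltf_pV2 ?posrE// ltr_nat ltnS.
Qed.

Lemma stage_time_ge0 k j : 0 <= stage_time k j.
Proof.
rewrite /stage_time subr_ge0 invf_le1; last first.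
  by rewrite ltr_wpDr ?ltr_wpDr ?invr_ge0.
by rewrite -addrA lerDl addr_ge0 ?invr_ge0.
Qed.

Lemma stage_time_lt1 k j : stage_time k j < 1.
Proof.
rewrite /stage_time ltrBlDr ltrDl invr_gt0.
by rewrite ltr_wpDr ?ltr_wpDr ?invr_ge0.
Qed.

(* [progress k j t] is the fraction, at time [t], of the [j]-th move of the
   [k]-th vector, from [e (k + j - 1)] to [e (k + j)]. *)
Definition progress k j t : R := if j is i.+1 then
  Num.max 0 (Num.min 1
    ((t - stage_time k.+1 i) / (stage_time k i - stage_time k.+1 i))) else 1.

Lemma progress_ge0 k j t : 0 <= progress k j t.
Proof. by case: j => //= j; rewrite le_max lexx. Qed.

Lemma progress_le1 k j t : progress k j t <= 1.
Proof. by case: j => //= j; rewrite ge_max ler01 ge_min lexx. Qed.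

Lemma progress0 k t : progress k 0 t = 1. Proof. by []. Qed.

Arguments progress : simpl never.

Lemma progress_eq0 k j t : t <= stage_time k.+1 j -> progress k j.+1 t = 0.
Proof.
move=> tk; rewrite /progress; apply/max_idPl; rewrite ge_min; apply/orP; right.
by rewrite pmulr_lle0 ?invr_gt0 ?subr_gt0 ?stage_time_ltS// subr_le0.
Qed.

Lemma progress_eq1 k j t : stage_time k j <= t -> progress k j.+1 t = 1.
Proof.
move=> tk; rewrite /progress; set x := _ / _.
have x1 : 1 <= x.
  by rewrite ler_pdivlMr ?subr_gt0 ?stage_time_ltS// mul1r lerD2r.
by rewrite (min_idPl x1); apply/max_idPr.
Qed.

(** A move starts only after the previous move of the same vector is complete: either the later
    factor is 0 or the earlier one is 1. *)
Lemma progress_pred k j t : progress k j t * progress k j.+1 t = progress k j.+1 t.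
Proof.
case: j => [|j]; first by rewrite progress0 mul1r.
have [tk|tk] := leP t (stage_time k.+1 j.+1).
  by rewrite [progress k j.+2 t]progress_eq0// mulr0.
rewrite [progress k j.+1 t]progress_eq1 ?mul1r//.
by rewrite (le_trans _ (ltW tk))// stage_time_le// ltnSn.
Qed.

Lemma progress_continuous k j : continuous (progress k j).
Proof.
case: j => [|j] t; first exact: cvg_cst.
pose f x : R^o := (x - stage_time k.+1 j) / (stage_time k j - stage_time k.+1 j).
have cf : {for t, continuous f}.
  apply: cvgM; last exact: cvg_cst.
  by apply: cvgB; [exact: cvg_id|exact: cvg_cst].
have cc (a : R) : {for t, continuous (cst a : R -> R^o)} by exact: cvg_cst.
exact: (continuous_max (cc 0) (continuous_min (cc 1) cf)).
Qed.

(** The coordinate along [e m] of the vector that started at [e k]. During a move, [progress] is the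
    sine of the rotation angle: it is the coordinate on the target, and the square root is the one
    on the source. *)
Definition coef k m t : R := if (k <= m)%N then
  progress k (m - k) t * Num.sqrt (1 - progress k (m - k).+1 t ^+ 2) else 0.

Lemma coef_eq0 k m t : (m < k)%N -> coef k m t = 0.
Proof. by rewrite /coef ltnNge => /negbTE->. Qed.

Lemma coef_continuous k m : continuous (coef k m).
Proof.
rewrite /coef; case: (k <= m)%N => t; last exact: cvg_cst.
apply: cvgM; first exact: progress_continuous.
apply: (@continuous_comp _ _ _ (fun t => 1 - progress k (m - k).+1 t ^+ 2) Num.sqrt).
  apply: cvgB; first exact: cvg_cst.
  by apply: cvgM; exact: progress_continuous.
exact: sqrt_continuous.
Qed.

(** All moves are over by time 1. With the continuity of [coef], this makes the adjoints of the path
    tend to 0. *)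
Lemma coef_ge1 k m t : 1 <= t -> coef k m t = 0.
Proof.
move=> t1; rewrite /coef; case: ifP => // _.
rewrite [progress k _.+1 t]progress_eq1 ?expr1n ?subrr ?sqrtr0 ?mulr0//.
by rewrite (le_trans _ t1)// ltW// stage_time_lt1.
Qed.

Lemma coef_at0 k m : coef k m 0 = (k == m)%:R.
Proof.
rewrite /coef leq_eqVlt; case: eqVneq => [->|km] /=.
  by rewrite subnn progress0 progress_eq0 ?stage_time_ge0// expr0n subr0 sqrtr1 mulr1.
case: ifP => // {}km.
move: km; rewrite -subn_gt0; case: (m - k)%N => // d _.
by rewrite progress_eq0 ?mul0r ?stage_time_ge0.
Qed.

(** Vector [l] has completely left [e m] before vector [k] starts to enter it, so at any time at
    most one of them has a component there. *)
Lemma coef_orthogonal k l m t : (k < l)%N -> coef k m t * coef l m t = 0.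
Proof.
move=> kl; have [ml|lm] := ltnP m l; first by rewrite [coef l m t]coef_eq0// mulr0.
rewrite /coef (leq_trans (ltnW kl) lm) lm.
have /subnKC := kl; have /subnKC := lm.
set i := (m - l)%N; set d := (l - k.+1)%N => mE lE.
rewrite (_ : (m - k)%N = (i + d).+1); last by lia.
have [tk|tk] := leP t (stage_time k.+1 (i + d)).
  by rewrite progress_eq0// !mul0r.
rewrite [progress l i.+1 t]progress_eq1 ?expr1n ?subrr ?sqrtr0 ?mulr0//.
rewrite (le_trans _ (ltW tk))// stage_time_le//.
(* For [l = k + 1] both moves belong to the same stage, where the larger index goes first; otherwise
   [l] leaves in an earlier stage. *)
have [->|d0] := posnP d; first by rewrite addn0 eqxx kl orbT.
by rewrite -[ltnLHS]addn0 ltn_add2l d0.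
Qed.

(** The sum telescopes: by [progress_pred] each new term is a difference of two consecutive squares
    of [progress]. *)
Lemma sum_coef_sqr k n t :
  \sum_(0 <= m < k + n) coef k m t ^+ 2 = 1 - progress k n t ^+ 2.
Proof.
elim: n => [|n IH].
  rewrite addn0 progress0 expr1n subrr big_nat_cond big1// => m /andP[/= mk _].
  by rewrite coef_eq0// expr0n.
rewrite addnS big_nat_recr//= IH /coef leq_addr addKn exprMn sqr_sqrtr; last first.
  by rewrite subr_ge0 expr_le1 ?progress_le1 ?progress_ge0.
rewrite mulrBr mulr1 -exprMn progress_pred; ring.
Qed.

(** A bound, uniform in [k], on the number of stages begun by time [t < 1]; it makes each moving
    vector a finite combination of the basis. *)
Definition stages t := (Num.truncn (1 - t)^-1).+1.

Lemma progress_stages k n t : t < 1 -> (stages t <= n)%N -> progress k n t = 0.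
Proof.
case: n => // n t1; rewrite ltnS => tn.
apply: progress_eq0; rewrite /stage_time lerBrDl -lerBrDr.
rewrite -[leRHS]invrK lef_pV2 ?posrE ?invr_gt0 ?subr_gt0//; last first.
  by rewrite ltr_wpDr ?ltr_wpDr ?invr_ge0.
rewrite (le_trans (ltW (truncnS_gt _)))// -natr1 addrC.
by rewrite -addrA lerD2l// ler_wpDr ?invr_ge0 ?ler_nat.
Qed.

End coefficients.

(** * Transport of a unitary operator to the range of an isometry *)

Section conjugation.
Context (R : realType) (H : completeNormedModType R[i]) (dot : {dot H for conjC}).
Hypothesis dot_norm : induces_norm dot.
Variable e : nat -> H.
Hypothesis e_basis : orthonormal_basis dot e.
Implicit Types (x y : H) (v : nat -> H) (U : H -> H).

Let e_on : orthonormal_family dot e := e_basis.1.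

Lemma pisom_basis x : pisom dot e e x = x.
Proof. by apply: cvg_lim => //; exact: e_basis.2. Qed.

(* [V U V^* + 1 - V V^*], for the isometry [V] mapping each [e k] to [v k]. *)
Definition corner v U x : H :=
  pisom dot e v (U (pisom dot v e x)) + (x - pisom dot v v x).

(** The summand [1 - V V^*] is annihilated by every [pisom v w]. *)
Lemma pisom_corner v w U x : orthonormal_family dot v -> orthonormal_family dot w ->
  pisom dot v w (corner v U x) = pisom dot e w (U (pisom dot v e x)).
Proof.
move=> von won; have lin := pisom_linear dot_norm von won.
rewrite /corner -[pisom dot e v _]scale1r lin scale1r pisom_comp//.
by rewrite [x - _]addrC -scaleN1r lin pisom_comp// scaleN1r addNr addr0.
Qed.

(** With [corner_id], this makes the corner of an inverse an inverse of the corner. *)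
Lemma corner_comp v U U' x : orthonormal_family dot v ->
  corner v U (corner v U' x) = corner v (U \o U') x.
Proof.
move=> von; rewrite {1}/corner !pisom_corner// pisom_basis /corner /=.
by congr (_ + _); rewrite addrAC subrr add0r.
Qed.

Lemma corner_id v x : orthonormal_family dot v -> corner v idfun x = x.
Proof. by move=> von; rewrite /corner pisom_comp// addrC subrK. Qed.

(** Only [V^*] appears on the right, which is why continuity of the adjoints will suffice. *)
Lemma dot_corner v U x y : orthonormal_family dot v ->
  dot (corner v U x) y = dot (U (pisom dot v e x)) (pisom dot v e y) + dot x y -
    dot (pisom dot v e x) (pisom dot v e y).
Proof.
move=> von; rewrite /corner -(pisom_comp dot_norm x von e_on von).
by rewrite linearDl/= linearBl/= !dot_pisoml// addrA.
Qed.

Lemma corner_unitary v U : orthonormal_family dot v -> unitary dot U ->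
  unitary dot (corner v U).
Proof.
move=> von [Ulin [U' UK U'K] Uiso]; split.
- move=> a x y; rewrite /corner !(pisom_linear dot_norm)// Ulin.
  rewrite (pisom_linear dot_norm)// scalerDr scalerBr.
  by rewrite opprD [a *: x + y + _]addrACA [LHS]addrACA.
- exists (corner v U') => x; rewrite corner_comp//.
    by rewrite (_ : U' \o U = idfun) ?corner_id//; exact/funext.
  by rewrite (_ : U \o U' = idfun) ?corner_id//; exact/funext.
- have dotU x y : dot (U x) (U y) = dot x y by exact: Uiso.
  move=> x y; rewrite -[LHS]/(dot (corner v U x) (corner v U y)) -[RHS]/(dot x y).
  (* [V^*] carries the corner to [U V^*]; a second use of [dot_corner], after conjugate symmetry,
     makes the extra terms cancel. *)
  rewrite dot_corner// pisom_corner// pisom_basis dotU.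
  rewrite [dot x (corner v U y)]dotC dot_corner//.
  rewrite raddfB raddfD/= -!dotC.
  ring.
Qed.


(** * The path of isometries and its adjoints *)

Let path t k : H := \sum_(0 <= m < k + stages t) (coef k m t)%:C *: e m.

Let dot_path t k m : t < 1 -> dot (path t k) (e m) = (coef k m t)%:C.
Proof.
move=> t1; rewrite (dot_sum_orthonormal (fun m => (coef k m t)%:C))// leq0n/=.
(* Past the cut-off the coefficients are 0 anyway, so truncation loses nothing. *)
case: ltnP => // km; rewrite /coef progress_stages ?mul0r ?if_same//; lia.
Qed.

Let conjC_realC (a : R) : conjC a%:C = a%:C :> R[i].
Proof. exact: conjc_real. Qed.

Let path_orthonormal t : t < 1 -> orthonormal_family dot (path t).
Proof.
move=> t1 k l.
have -> : dot (path t k) (path t l) =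
    (\sum_(0 <= m < k + stages t) coef k m t * coef l m t)%:C.
  rewrite linear_sumlz rmorph_sum /=; apply: eq_bigr => m _.
  by rewrite dotZl [dot (e m) _]dotC dot_path// rmorphM /= conjC_realC.
have [->|kl] := eqVneq k l.
  by rewrite sum_coef_sqr progress_stages// expr0n subr0.
rewrite big1// => m _; case: (ltngtP k l) kl => // kl _.
  exact: coef_orthogonal.
by rewrite mulrC coef_orthogonal.
Qed.

Let path0 : path 0 = e.
Proof.
apply/funext => k; rewrite /path.
under eq_bigr do rewrite coef_at0 [(_ == _)%:R%:C]rmorph_nat scaler_nat mulrb eq_sym.
by rewrite -big_mkcond/= big_nat1_eq leq0n -[ltnLHS]addn0 ltn_add2l.
Qed.

(** The adjoint [V t^*], continued from time 1 on by its strong limit 0. *)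
Let pull t x : H := if t < 1 then pisom dot (path t) e x else 0.

Let pull_linear t : linear (pull t).
Proof.
rewrite /pull; case: ltP => [t1|_ a x y]; last by rewrite scaler0 addr0.
by apply: pisom_linear => //; exact: path_orthonormal.
Qed.

Let pull0 t : pull t 0 = 0.
Proof.
have := pull_linear t (-1) 0 0.
by rewrite scaler0 addr0 scaleN1r addNr.
Qed.

Let norm_pull t x : `|pull t x| <= `|x|.
Proof.
rewrite /pull; case: ltP => [t1|_]; last by rewrite normr0.
by apply: norm_pisom => //; exact: path_orthonormal.
Qed.

(** Vector [k] never has components below [e k], so the sum is finite. The formula also covers
    [1 <= t], so continuity at 1 needs no separate treatment. *)
Let pull_basis t m : pull t (e m) = \sum_(0 <= k < m.+1) (coef k m t)%:C *: e k.
Proof.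
rewrite /pull; case: ltP => [t1|t1]; last first.
  by rewrite big1// => k _; rewrite coef_ge1// scale0r.
apply: cvg_lim => //; apply: cvg_near_cst; exists m.+1 => // n /= mn.
rewrite /series /= (big_nat_widen _ _ _ _ _ mn) [RHS]big_mkcond/=.
apply: eq_bigr => k _; rewrite dotC dot_path// conjC_realC.
by case: ltnP => // mk; rewrite coef_eq0// scale0r.
Qed.

Let cvg_realC (f : R -> R) t : {for t, continuous f} ->
  (fun s => (f s)%:C : R[i]^o) @ t --> ((f t)%:C : R[i]^o).
Proof.
move=> /cvgrPdist_lt ft; apply/cvgrPdist_lt => r r0.
have rE : (complex.Re r)%:C = r by rewrite RRe_real// gtr0_real.
rewrite -rE ltcR in r0; have := ft _ r0; apply: filterS => s.
by rewrite -ltcR rE -rmorphB normc_def /= expr0n addr0 sqrtr_sqr.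
Qed.

(** On a partial sum [y] of the expansion of [x], continuity is that of the coefficients;
    contractivity of [pull s], uniform in [s], absorbs the two errors due to [x - y]. *)
Let pull_continuous x t : (fun s => pull s x) @ t --> pull t x.
Proof.
apply/cvgrPdist_lt => r r0.
have r3 : 0 < r / 3 by rewrite divr_gt0.
have [n nx] : exists n, `|x - series (fun k => dot x (e k) *: e k) n| < r / 3.
  have /cvgrPdist_lt/(_ _ r3) := e_basis.2 x.
  by move=> [n _ h]; exists n; exact: h (leqnn n).
set y := series _ n in nx.
have /cvgrPdist_lt/(_ _ r3) yt : (fun s => pull s y) @ t --> pull t y.
  have pullE s : pull s y = \sum_(0 <= m < n)
      dot x (e m) *: (\sum_(0 <= k < m.+1) (coef k m s)%:C *: e k).
    under eq_bigr do rewrite -pull_basis.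
    rewrite /y /series /=; elim: (index_iota 0 n) => [|m l IH].
      by rewrite !big_nil pull0.
    by rewrite !big_cons pull_linear IH.
  rewrite pullE; under eq_cvg do rewrite pullE.
  have sum_cvg (l : seq nat) (f : nat -> R -> H) :
      (forall i, f i s @[s --> t] --> f i t) ->
      \sum_(i <- l) f i s @[s --> t] --> \sum_(i <- l) f i t.
    move=> ft; elim: l => [|i l IH] /=.
      by rewrite big_nil; under eq_cvg do rewrite big_nil; exact: cvg_cst.
    by rewrite big_cons; under eq_cvg do rewrite big_cons; exact: cvgD.
  apply: (sum_cvg) => m; apply: cvgZl_tmp; apply: sum_cvg => k.
  by apply: cvgZr_tmp; apply: cvg_realC; exact: coef_continuous.
have pullB s : pull s x - pull s y = pull s (x - y).
  by rewrite [x - y]addrC -[- y]scaleN1r pull_linear scaleN1r addrC.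
near=> s.
rewrite (_ : pull t x - pull s x =
    pull t (x - y) + (pull t y - pull s y) - pull s (x - y)); last first.
  rewrite -!pullB; set a := pull t x; set b := pull t y.
  by rewrite addrA subrK opprB addrA subrK.
rewrite (le_lt_trans (ler_normB _ _))//.
rewrite (_ : r = r / 3 + r / 3 + r / 3); last by field.
rewrite ltrD ?(le_lt_trans (norm_pull _ _))//.
rewrite (le_lt_trans (ler_normD _ _))// ltrD ?(le_lt_trans (norm_pull _ _))//.
by near: s.
Unshelve. all: by end_near. Qed.

(** * The homotopy and its joint continuity *)

Let homotopy_map t (U : H -> H) : H -> H := if t < 1 then corner (path t) U else idfun.

Let homotopy_unitary t U : unitary dot U -> unitary dot (homotopy_map t U).
Proof.
rewrite /homotopy_map; case: ltP => [t1|_ _]; last exact: unitary_id.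
by apply: corner_unitary; exact: path_orthonormal.
Qed.

(** As [pull] vanishes from time 1 on, the formula for corners also yields the identity operator, so
    one expression covers all [t]. *)
Let dot_homotopy t U x y : unitary dot U -> dot (homotopy_map t U x) y =
  dot (U (pull t x)) (pull t y) + dot x y - dot (pull t x) (pull t y).
Proof.
rewrite /homotopy_map /pull; case: ltP => [t1|_] uU.
  by rewrite dot_corner//; exact: path_orthonormal.
by rewrite !linear0r subr0 add0r.
Qed.

Let norm_unitary (U : unitary_group dot) x : `|set_val U x| = `|x|.
Proof.
have [_ _ Uiso] := unitary_groupP U.
apply/eqP; rewrite -(eqrXn2 (n := 2))// !dot_norm; apply/eqP; exact: Uiso.
Qed.

Let homotopy (p : R * unitary_group dot) : unitary_group dot :=
  to_unitary (homotopy_unitary p.1 (unitary_groupP p.2)).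

Let unitaryB (U : unitary_group dot) x y :
  set_val U (x - y) = set_val U x - set_val U y.
Proof.
have [Ulin _ _] := unitary_groupP U.
by rewrite addrC -scaleN1r Ulin scaleN1r addrC.
Qed.

Let homotopy_continuous : continuous homotopy.
Proof.
move=> [t U]; apply/strong_normP => x r r0.
have pullx y : (fun p : R * unitary_group dot => pull p.1 y) @ (t, U) --> pull t y.
  apply: (@cvg_comp _ _ _ fst (pull ^~ y) _ (nbhs t)); first exact: cvg_fst.
  exact: pull_continuous.
have Upull : (fun p : R * unitary_group dot => set_val p.2 (pull p.1 x)) @ (t, U) -->
    set_val U (pull t x).
  apply/cvgrPdist_lt => d d0; have d2 : 0 < d / 2 by rewrite divr_gt0.
  have /cvgrPdist_lt/(_ _ d2) Ux :
      (fun p : R * unitary_group dot => set_val p.2 (pull t x)) @ (t, U) -->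
      set_val U (pull t x).
    have /strong_cvgP : (fun p : R * unitary_group dot => p.2) @ (t, U) --> U.
      exact: cvg_snd.
    exact.
  have /cvgrPdist_lt/(_ _ d2) px := pullx x.
  near=> p.
  (* The varying operator is isometric, so changing its argument from [pull t x] to [pull p.1 x]
     costs only the distance between them. *)
  rewrite -[X in X - _](subrK (set_val p.2 (pull t x))) -addrA -unitaryB.
  rewrite (le_lt_trans (ler_normD _ _))// norm_unitary (splitr d).
  by rewrite ltrD//; near: p.
(* Weak convergence is tested against the limit vector itself. *)
set z := set_val (homotopy (t, U)) x.
have Fz : (fun p : R * unitary_group dot =>
    dot (set_val (homotopy p) x) z : R[i]^o) @ (t, U) --> (dot z z : R[i]^o).
  have Fz p : dot (set_val (homotopy p) x) z = dot (set_val p.2 (pull p.1 x))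
      (pull p.1 z) + dot x z - dot (pull p.1 x) (pull p.1 z).
    by apply: dot_homotopy; exact: unitary_groupP.
  rewrite [X in _ --> X]Fz; under eq_cvg do rewrite Fz.
  apply: cvgB; last exact: dot_cvg.
  by apply: cvgD; [exact: dot_cvg|exact: cvg_cst].
have r2 : 0 < r ^+ 2 / 2 by rewrite divr_gt0// exprn_gt0.
have /cvgrPdist_lt/(_ _ r2) := Fz.
apply: filterS => p /=; set w := set_val (homotopy p) x => zw.
rewrite -(ltr_pXn2r (n := 2)) ?nnegrE// ?(ltW r0)//.
have ww : dot w w = dot z z by rewrite -!dot_norm !norm_unitary.
(* As [w] and [z] have equal norms, the squared distance is twice the real part of
   [<z,z> - <w,z>]. *)
have -> : `|z - w| ^+ 2 = `|(dot z z - dot w z) + conjC (dot z z - dot w z)|.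
  rewrite dot_norm -[LHS]ger0_norm ?dnorm_ge0// dnormB ww rmorphB/= -!dotC.
  by congr (normr _); ring.
by rewrite (le_lt_trans (ler_normD _ _))// norm_conjC (splitr (r ^+ 2)) ltrD.
Unshelve. all: by end_near. Qed.

Lemma unitary_group_contractible : contractible R (unitary_group dot).
Proof.
exists (to_unitary (unitary_id dot)), homotopy; split.
- exact/continuous_subspaceT/homotopy_continuous.
- move=> U; apply: unitary_group_inj => x.
  rewrite -[LHS]/(homotopy_map 0 (set_val U) x) /homotopy_map ltr01 path0.
  by rewrite /corner !pisom_basis subrr addr0.
- move=> U; apply: unitary_group_inj => x.
  by rewrite -[LHS]/(homotopy_map 1 (set_val U) x) /homotopy_map ltxx.
Qed.

End conjugation.

Theorem mainTheorem4 (R : realType) (H : completeNormedModType R[i])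
    (dot : {dot H for conjC}) :
  induces_norm dot -> infinite_dimensional H -> separable_space H ->
  contractible R (unitary_group dot).
Proof.
move=> dot_norm dimH sepH.
have [e e_basis] := orthonormal_basis_exists dot_norm dimH sepH.
exact: (unitary_group_contractible dot_norm e_basis).
Qed.
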